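(* Let $1\le p<2$, let $f\in\mathcal H_0$, let $u$ solve the gradient flow $\partial_tu+\partial J(u)\ni0$, $u(0)=f$, with (finite) extinction time $T_{\mathrm{ex}}$, and set $\lambda:=\frac{1}{(2-p)T_{\mathrm{ex}}}$, $a(t):=(1-(2-p)\lambda t)^{\frac1{2-p}}$ and $w(t):=u(t)/a(t)$ for $0\le t<T_{\mathrm{ex}}$. Assume that there are $w_*\in\mathcal H$ and a sequence $t_k\nearrow T_{\mathrm{ex}}$ with $w(t_k)\to w_*$ strongly in $\mathcal H$ (or that $w(t)\to w_*$ strongly as $t\to T_{\mathrm{ex}}$). Then $\lambda w_*\in\partial J(w_* )$, $w_*\ne 0$, and $\|w_*\|\le\|f\|$.
   Context: $\mathcal H$ is a real Hilbert space with inner product $\langle\cdot,\cdot\rangle$ and norm $\|\cdot\|$. $J:\mathcal H\to\mathbb R\cup\{\infty\}$ is convex, lower semicontinuous, proper, with dense effective domain, and absolutely $p$-homogeneous: $J(cu)=|c|^pJ(u)$ for $c\ne0$ and $J(0)=0$. Standing coercivity assumption: $\lambda_1:=\inf_{u\in\mathcal H_0}pJ(u)/\|u\|^p>0$. $\partial J(u)=\{\zeta: J(u)+\langle\zeta,v-u\rangle\le J(v)\ \forall v\}$; $\mathcal N(J)=\{u:J(u)=0\}$; $\mathcal H_0:=\mathcal N(J)^\perp\setminus\{0\}$. The gradient flow solution (Brezis) is the unique continuous $u:[0,\infty)\to\mathcal H$, Lipschitz on $[\delta,\infty)$ for all $\delta>0$, right-differentiable on $(0,\infty)$ with $u(0)=f$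 and $\partial_t^+u(t)=-\zeta(t)$, $\zeta(t)$ the minimal-norm element of $\partial J(u(t))$. $T_{\mathrm{ex}}:=\inf\{T>0:u(t)=0\ \forall t\ge T\}$, which is finite for $p<2$. The function $a$ is the solution of $a'=-\lambda a^{p-1}$, $a(0)=1$, i.e. $a(t)=(1-t/T_{\mathrm{ex}})^{1/(2-p)}$. *)

(* Defs.v *)
From HB Require Import structures.
From mathcomp Require Import all_boot all_order all_algebra.
From mathcomp Require Import all_classical all_reals all_analysis.
Set Implicit Arguments. Unset Strict Implicit. Unset Printing Implicit Defensive.
Import Order.TTheory GRing.Theory Num.Theory.
Import numFieldNormedType.Exports.
Local Open Scope classical_set_scope.
Local Open Scope ring_scope.

Section Defs.
Variables (R : realType) (V : completeNormedModType R).

(* A real Hilbert space: a complete normed space whose norm comes from an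
   inner product [ip]. *)
Definition is_inner_product (ip : V -> V -> R) : Prop :=
  [/\ (forall x y, ip x y = ip y x),
      (forall a x y z, ip (a *: x + y) z = a * ip x z + ip y z) &
      (forall x, ip x x = `|x| ^+ 2)].

Definition convex_fun (J : V -> \bar R) : Prop :=
  forall (t : R) x y, 0 <= t <= 1 ->
    (J (t *: x + (1 - t) *: y)%R <= t%:E * J x + (1 - t)%:E * J y)%E.

Definition lsc (J : V -> \bar R) : Prop :=
  forall x (r : R), (r%:E < J x)%E -> \forall y \near x, (r%:E < J y)%E.

Definition proper_fun (J : V -> \bar R) : Prop :=
  (forall x, J x != -oo%E) /\ exists x, (J x < +oo)%E.

Definition dom (J : V -> \bar R) : set V := [set x | (J x < +oo)%E].

Definition dense_domain (J : V -> \bar R) : Prop := closure (dom J) = setT.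

Definition abs_homogeneous (p : R) (J : V -> \bar R) : Prop :=
  (forall (c : R) u, c != 0 -> J (c *: u)%R = ((`|c| `^ p)%:E * J u)%E) /\
  J 0 = 0%E.

Definition nullspace (J : V -> \bar R) : set V := [set u | J u = 0%E].

Definition H0 (ip : V -> V -> R) (J : V -> \bar R) : set V :=
  [set u | (forall v, nullspace J v -> ip u v = 0) /\ u != 0].

(* lambda_1 := inf_{u in H_0} p J(u) / ||u||^p > 0, written out as the
   existence of a positive lower bound *)
Definition coercive (ip : V -> V -> R) (p : R) (J : V -> \bar R) : Prop :=
  exists c : R, 0 < c /\
    forall u, H0 ip J u -> ((c * `|u| `^ p)%R%:E <= p%:E * J u)%E.

Definition subdiff (ip : V -> V -> R) (J : V -> \bar R) (u : V) : set V :=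
  [set zeta | forall v, (J u + (ip zeta (v - u)%R)%:E <= J v)%E].

Definition min_norm_subgrad (ip : V -> V -> R) (J : V -> \bar R) (u zeta : V)
  : Prop :=
  subdiff ip J u zeta /\ forall eta, subdiff ip J u eta -> `|zeta| <= `|eta|.

(* Brezis gradient-flow solution of  u' + dJ(u) \ni 0, u(0) = f,
   on [0, oo) (the values of u on negative times are irrelevant) *)
Definition gradient_flow (ip : V -> V -> R) (J : V -> \bar R) (f : V)
  (u : R -> V) : Prop :=
  [/\ {within [set t : R | 0 <= t], continuous u},
      (forall delta : R, 0 < delta -> exists L : R,
          forall s t, delta <= s -> delta <= t -> `|u s - u t| <= L * `|s - t|),
      u 0 = f &
      (forall t : R, 0 < t -> exists zeta : V,
          min_norm_subgrad ip J (u t) zeta /\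
          (fun h : R => h^-1 *: (u (t + h) - u t)) @ 0^'+ --> - zeta)].

(* the set whose infimum is the extinction time *)
Definition extinct_set (u : R -> V) : set R :=
  [set T | 0 < T /\ forall t, T <= t -> u t = 0].

End Defs.

(* Main.v *)
(* The quotient [L t = p * J (u t) / |u t| ^ p] is nonincreasing along the flow,
   and [|u t| ^ (2 - p)] has right derivative [- (2 - p) * L t]; it is therefore
   convex and vanishes at the extinction time T, which gives
   [|w| <= |f|] and [|w t| ^ (2 - p) -> (lim L) / lambda > 0].
   Since J (w t) = L t * |w t| ^ p / p, lower semicontinuity yields
   [J w* <= lambda * |w*| ^ 2 / p].  Conversely, testing the subgradients with
   the competitor [a r *: v] on [t, T] and letting [t = t_k -> T] yields
   [lambda * <w*, v> <= J v + (1 - 1 / p) * lambda * |w*| ^ 2].  The two bounds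
   add up to the subgradient inequality.  Only right derivatives and a mean
   value inequality for them are used, no time integration. *)

Require Import Defs.
From HB Require Import structures.
From mathcomp Require Import all_boot all_order all_algebra.
From mathcomp Require Import all_classical all_reals all_analysis.
From mathcomp Require Import ring lra.
Import Order.TTheory GRing.Theory Num.Theory.
Import numFieldNormedType.Exports.
Local Open Scope classical_set_scope.
Local Open Scope ring_scope.

(** * Right derivatives and a mean value inequality for them *)

Section RealAnalysis.
Set Implicit Arguments.
Unset Strict Implicit.
Context {R : realType}.
Implicit Types (a b t l : R) (g : R -> R).

(** The witness is the supremum of the points of [[a, b]] satisfying [P]. The set where [P] fails
    only has to be open to the left, so that lower semicontinuity suffices for a condition such as
    [rayleigh r <= rayleigh s]. *)
Lemma last_point (P : R -> Prop) a b : a < b -> P a -> ~ P b ->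
  (forall x, a < x <= b -> ~ P x -> \forall y \near x^'-, ~ P y) ->
  exists2 t, a <= t < b /\ P t & forall r, t < r <= b -> ~ P r.
Proof.
move=> ab Pa nPb left_open.
pose S := [set x | a <= x <= b /\ P x].
have S0 : S !=set0 by exists a; split=> //; rewrite lexx ltW.
have ubS : ubound S b by move=> x [/andP[]].
have supS : has_sup S by split=> //; exists b.
have aS : a <= sup S.
  by apply: ub_le_sup; [exists b | split=> //; rewrite lexx ltW].
have Sb : sup S <= b by exact: ge_sup.
have PS : P (sup S).
  apply: contrapT => nPS.
  have aS' : a < sup S.
    by rewrite lt_neqAle aS andbT; apply/eqP => aE; apply: nPS; rewrite -aE.
  have /left_open/(_ nPS) : a < sup S <= b by rewrite aS'.
  move=> /nbhs_ballP[e /= e0 He].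
  have [x Sx xS] := sup_adherent e0 supS.
  have Px := Sx.2.
  have xle : x <= sup S by apply: ub_le_sup => //; exists b.
  have := xle; rewrite le_eqVlt => /predU1P[xE|xlt].
    by apply: nPS; rewrite -xE.
  suff /He/(_ xlt) : ball (sup S) e x by [].
  by rewrite /ball /= ger0_norm ?subr_ge0//; lra.
exists (sup S).
  split=> //; rewrite aS lt_neqAle Sb andbT /=.
  by apply/eqP => SE; apply: nPb; rewrite -SE.
move=> r /andP[Sr rb] Pr; have : r <= sup S.
  apply: ub_le_sup; first by exists b.
  by split=> //; rewrite rb (le_trans aS (ltW Sr)).
by rewrite leNgt Sr.
Qed.

Definition rderiv (g : R -> R) (t l : R) : Prop :=
  (fun h : R => h^-1 * (g (t + h) - g t)) @ 0^'+ --> l.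

Lemma rderiv_cvg g t l : rderiv g t l -> (fun h => g (t + h)) @ 0^'+ --> g t.
Proof.
move=> gl.
have id0 : (fun h : R => h) @ 0^'+ --> (0 : R) by exact: cvg_at_right_filter.
have /= : (fun h : R => h * (h^-1 * (g (t + h) - g t)) + g t) @ 0^'+
    --> 0 * l + g t.
  by apply: cvgD; [exact: cvgM | exact: cvg_cst].
rewrite mul0r add0r; apply: cvg_trans; apply: near_eq_cvg; near=> h.
have h0 : h != 0 by rewrite gt_eqF//; near: h; exact: nbhs_right_gt.
by rewrite mulrA mulfV// mul1r subrK.
Unshelve. all: by end_near. Qed.

(** The slope function [k] of Caratheodory avoids a division by [g (t + h) - g t], which may
    vanish. *)
Lemma rderiv_comp (phi : R -> R) g t l d : rderiv g t l ->
  is_derive (g t) 1 phi d -> rderiv (phi \o g) t (d * l).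
Proof.
move=> gl /is_derive1_caratheodory [k [phiE kc <-]].
have gc := rderiv_cvg gl.
apply: cvg_trans (cvgM (cvg_comp _ _ gc kc) gl); apply: near_eq_cvg.
by apply: nearW => h /=; rewrite phiE; ring.
Qed.

Lemma rderivD g1 g2 t l1 l2 : rderiv g1 t l1 -> rderiv g2 t l2 ->
  rderiv (fun s => g1 s + g2 s) t (l1 + l2).
Proof.
move=> h1 h2; apply: cvg_trans (cvgD h1 h2); apply: near_eq_cvg.
by apply: nearW => h; rewrite !fctE; ring.
Qed.

Lemma rderivZ k g t l : rderiv g t l -> rderiv (fun s => k * g s) t (k * l).
Proof.
move=> h1; apply: cvg_trans (cvgM (cvg_cst k) h1); apply: near_eq_cvg.
by apply: nearW => h /=; ring.
Qed.

Lemma rderiv_aff k c t : rderiv (fun s => c + k * s) t k.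
Proof.
apply: (@cvg_trans _ ((fun=> k) @ 0^'+)); last exact: cvg_cst.
apply: near_eq_cvg; near=> h.
have h0 : h != 0 by rewrite gt_eqF//; near: h; exact: nbhs_right_gt.
by rewrite /=; field.
Unshelve. all: by end_near. Qed.

Lemma rderiv_lt0 g t l : rderiv g t l -> l < 0 ->
  \forall h \near 0^'+, g (t + h) < g t.
Proof.
move=> gl l0; have /cvgr_lt/(_ _ l0) := gl; apply: filter_app; near=> h => hl.
have h0 : 0 < h by near: h; exact: nbhs_right_gt.
by move: hl; rewrite pmulr_rlt0 ?invr_gt0// subr_lt0.
Unshelve. all: by end_near. Qed.

Lemma right_shift (P : R -> Prop) t :
  (\forall h \near 0^'+, P (t + h)) -> \forall r \near t^'+, P r.
Proof.
move=> /nbhs_ballP[e /= e0 He]; apply/nbhs_ballP; exists e => //= r rt tr.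
have := He (r - t); rewrite subrKC; apply; last by rewrite subr_gt0.
by move: rt; rewrite /ball /= sub0r normrN distrC.
Qed.

(** If [g a' + e < g b], tilting [g] by the slope [d] gives [h a' <= 0 < h b]. At the last point
    where [h <= 0] the right derivative of [h] is negative, so [h <= 0] persists a little longer, a
    contradiction. The left end is first an interior point [a'], where a right derivative is
    available, and then tends to [a]. *)
Lemma rderiv_le0_noninc g a b : a < b ->
  (forall t, a < t < b -> {for t, continuous g}) ->
  g @ a^'+ --> g a -> g @ b^'- --> g b ->
  (forall t, a < t < b -> exists2 l, rderiv g t l & l <= 0) ->
  g b <= g a.
Proof.
move=> ab gc gca gcb gd.
have inner a' : a < a' < b -> g b <= g a'.
  move=> /andP[aa' a'b]; apply/ler_addgt0Pr => e e0; rewrite leNgt.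
  apply/negP => gab.
  pose d := e / (b - a').
  have d0 : 0 < d by rewrite divr_gt0// subr_gt0.
  pose h x := g x + ((- (g a') + d * a') + (- d) * x).
  have hb : ~ (h b <= 0).
    apply/negP; rewrite -ltNge /h.
    have : d * (b - a') = e by rewrite divfK// gt_eqF// subr_gt0.
    by nra.
  have ha : h a' <= 0 by rewrite /h; nra.
  have hc x : g @ x^'- --> g x -> h @ x^'- --> h x.
    move=> gx; apply: cvgD => //; apply: cvgD; first exact: cvg_cst.
    by apply: cvgM; [exact: cvg_cst | exact: cvg_at_left_filter].
  have [|t [/andP[a't tb] ht] hr] :=
    @last_point (fun x => h x <= 0) a' b a'b ha hb.
    move=> x /andP[a'x xb] /negP; rewrite -ltNge => hx.
    have hcx : h @ x^'- --> h x.
      apply: hc; move: xb; rewrite le_eqVlt => /predU1P[->//|xb].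
      by apply: cvg_at_left_filter; apply: gc; rewrite (lt_trans aa').
    have /cvgr_gt/(_ _ hx) := hcx; apply: filterS => y hy; apply/negP.
    by rewrite -ltNge.
  have [|l gl l0] := gd t; first by rewrite (lt_le_trans aa').
  have hl : rderiv h t (l + (- d)) by apply: rderivD => //; exact: rderiv_aff.
  have hlt : \forall r \near t^'+, h r < h t.
    by apply: right_shift; apply: (rderiv_lt0 hl); lra.
  have : \forall r \near t^'+, False; last by case/filter_ex.
  near=> r.
  have /hr : t < r <= b.
    apply/andP; split; first by near: r; exact: nbhs_right_gt.
    by near: r; exact: nbhs_right_le.
  by apply; apply: le_trans ht; apply: ltW; near: r.
apply: (cvgr_to_ge gca); near=> a'; apply: inner; apply/andP; split.
  by near: a'; exact: nbhs_right_gt.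
by near: a'; exact: nbhs_right_lt.
Unshelve. all: by end_near. Qed.

Lemma continuous_powR (q x : R) : 0 < x -> {for x, continuous (@powR R ^~ q)}.
Proof.
move=> x0; apply: differentiable_continuous; apply/derivable1_diffP.
by apply: derivable_powR; rewrite in_itv/= x0.
Qed.

(** The case [l = 0], proved by hand, serves at the extinction time, where both the norm and the
    profile vanish. *)
Lemma cvg_powR {T : Type} {F : set_system T} {FF : Filter F} (f : T -> R)
    (l q : R) : 0 < q -> (\forall x \near F, 0 <= f x) -> 0 <= l ->
  f @ F --> l -> (fun x => f x `^ q) @ F --> l `^ q.
Proof.
move=> q0 f0; rewrite le_eqVlt => /predU1P[<-|l0] fl; last first.
  exact: (cvg_comp _ _ fl (@continuous_powR q l l0)).
rewrite powR0 ?gt_eqF//; apply/cvgr0Pnorm_lt => e e0.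
have e1 : 0 < e `^ q^-1 by rewrite powR_gt0.
have /cvgr_lt/(_ _ e1) := fl; apply: filter_app; move: f0; apply: filter_app.
apply: nearW => x fx0 fxe; rewrite ger0_norm ?powR_ge0//.
have -> : e = (e `^ q^-1) `^ q by rewrite -powRrM mulVf ?gt_eqF// powRr1// ltW.
by apply: gt0_ltr_powR => //; rewrite nnegrE ?powR_ge0.
Qed.

End RealAnalysis.

(** * Inner product calculus *)

Section InnerProduct.
Set Implicit Arguments.
Unset Strict Implicit.
Context {R : realType} {V : completeNormedModType R} {ip : V -> V -> R}.
Context (hip : is_inner_product ip).
Implicit Types (x y z : V).

Lemma ipC x y : ip x y = ip y x. Proof. by case: hip. Qed.

Lemma ipxx x : ip x x = `|x| ^+ 2. Proof. by case: hip. Qed.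

Lemma ipDl x y z : ip (x + y) z = ip x z + ip y z.
Proof. by case: hip => _ h _; rewrite -[x]scale1r h mul1r scale1r. Qed.

Lemma ip0l z : ip 0 z = 0.
Proof. by apply: (@addrI _ (ip 0 z)); rewrite -ipDl !addr0. Qed.

Lemma ipZl a x z : ip (a *: x) z = a * ip x z.
Proof. by case: hip => _ h _; rewrite -[a *: x]addr0 h ip0l addr0. Qed.

Lemma ipNl x z : ip (- x) z = - ip x z.
Proof. by rewrite -scaleN1r ipZl mulN1r. Qed.

Lemma ipBl x y z : ip (x - y) z = ip x z - ip y z.
Proof. by rewrite ipDl ipNl. Qed.

Lemma ipZr a x z : ip x (a *: z) = a * ip x z.
Proof. by rewrite ipC ipZl ipC. Qed.

Lemma ipBr x y z : ip z (x - y) = ip z x - ip z y.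
Proof. by rewrite ipC ipBl !(ipC z). Qed.

Lemma ipDr x y z : ip z (x + y) = ip z x + ip z y.
Proof. by rewrite ipC ipDl !(ipC z). Qed.

Lemma polarization x y :
  ip x y = 2^-1 * (`|x + y| ^+ 2 - `|x| ^+ 2 - `|y| ^+ 2).
Proof. by rewrite -!ipxx ipDl !ipDr (ipC y x); field. Qed.

(** Polarization reduces Cauchy-Schwarz to the squared triangle inequality of the norm. *)
Lemma ip_le x y : ip x y <= `|x| * `|y|.
Proof.
rewrite polarization.
have := ler_normD x y; have := normr_ge0 (x + y); have := normr_ge0 x.
by have := normr_ge0 y; nra.
Qed.

Lemma cvg_ip {T} {F : set_system T} {FF : Filter F} (f g : T -> V) x y :
  f @ F --> x -> g @ F --> y -> (fun t => ip (f t) (g t)) @ F --> ip x y.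
Proof.
move=> fx gy; rewrite polarization.
under eq_fun do rewrite polarization.
have cvg_sqr (h : T -> V) z : h @ F --> z ->
    (fun t => `|h t| ^+ 2) @ F --> `|z| ^+ 2.
  move=> hz; apply: (@cvg_comp _ _ _ _ (fun r : R => r ^+ 2) F _ _
    (cvg_norm hz)).
  exact: exprn_continuous.
apply: cvgM; first exact: cvg_cst.
by apply: cvgB; [apply: cvgB|]; apply: cvg_sqr => //; exact: cvgD.
Qed.

End InnerProduct.

(** * Convex homogeneous functionals and their subgradients *)

Section Functional.
Set Implicit Arguments.
Unset Strict Implicit.
Context {R : realType} {V : completeNormedModType R} {ip : V -> V -> R}.
Context {J : V -> \bar R} {p : R}.
Context (hip : is_inner_product ip) (Jconv : convex_fun J).
Context (Jhom : abs_homogeneous p J).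
Implicit Types (x y u v zeta : V).

Lemma homN v : J (- v) = J v.
Proof.
by rewrite -scaleN1r Jhom.1 ?oppr_eq0 ?oner_neq0// normrN1 powR1 mul1e.
Qed.

(** The origin is the midpoint of [v] and [- v], at which [J] takes the same value. *)
Lemma hom_ge0 v : (0 <= J v)%E.
Proof.
have := @Jconv (2^-1) v (- v).
have -> : 2^-1 *: v + (1 - 2^-1) *: (- v) = 0.
  have -> : 1 - 2^-1 = 2^-1 :> R by field.
  by rewrite scalerN subrr.
rewrite Jhom.2 homN.
have -> : (1 - 2^-1 = 2^-1 :> R) by field.
have h : 0 <= (2^-1 : R) <= 1 by apply/andP; split; lra.
move=> /(_ h).
case: (J v) => [r| |] /=; first by rewrite -!EFinM -EFinD !lee_fin; lra.
  by rewrite leey.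
by rewrite gt0_muleNy ?lte_fin//.
Qed.

Lemma fin_num_scale c v : J v \is a fin_num -> J (c *: v) \is a fin_num.
Proof.
move=> Jv; have [->|c0] := eqVneq c 0; first by rewrite scale0r Jhom.2.
by rewrite Jhom.1// fin_numM.
Qed.

Lemma fine_scale c v : 0 < c -> J v \is a fin_num ->
  fine (J (c *: v)) = c `^ p * fine (J v).
Proof.
by move=> c0 Jv; rewrite Jhom.1 ?gt_eqF// fineM// gtr0_norm.
Qed.

Lemma subdiff_fin_num u zeta : subdiff ip J u zeta -> J u \is a fin_num.
Proof.
move=> /(_ 0); rewrite Jhom.2; have := hom_ge0 u.
by case: (J u).
Qed.

Lemma subdiff_fine u zeta v : subdiff ip J u zeta -> J v \is a fin_num ->
  fine (J u) + ip zeta (v - u) <= fine (J v).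
Proof.
move=> uz /fineK Jv; have /fineK Ju := subdiff_fin_num uz.
by have := uz v; rewrite -Jv -Ju -EFinD lee_fin.
Qed.

(** Euler's identity: by the subgradient inequality with competitor [c *: u], the function [phi] is
    minimal at [c = 1], and its derivative there is [p * j - e]. *)
Lemma subdiff_euler u zeta : subdiff ip J u zeta -> ip zeta u = p * fine (J u).
Proof.
move=> uz; have Ju := subdiff_fin_num uz.
set j := fine (J u); set e := ip zeta u.
pose phi := (fun c : R => c `^ p * j - (c - 1) * e).
have dphi (c : R) : 0 < c -> is_derive c 1 phi (p * c `^ (p - 1) * j - e).
  move=> c0; have ? := is_derive1_powR p c0.
  by apply: is_derive_eq; rewrite /GRing.scale /=; ring.
have h1 : (1 : R) \in `]0, 2[ by rewrite in_itv/=; lra.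
have : is_derive (1 : R) 1 phi 0.
  apply: (@derive1_at_min _ phi 0 2) => //.
    by move=> t; rewrite in_itv/= => /andP[t0 _]; have := dphi _ t0; case.
  move=> t; rewrite in_itv/= => /andP[t0 _]; rewrite /phi powR1.
  have := subdiff_fine uz (fin_num_scale t Ju).
  by rewrite fine_scale// (ipBr hip) (ipZr hip) -/j -/e; lra.
have := dphi _ ltr01; rewrite powR1 mulr1 => d1 d2.
have := @derive_val _ _ _ _ _ _ _ d1; have := @derive_val _ _ _ _ _ _ _ d2.
by move=> ->; lra.
Qed.

(** The competitor is [c *: v], and Euler's identity eliminates [ip zeta u]. The free scale [c] is
    what the later arguments exploit. *)
Lemma subdiff_test u zeta v c : subdiff ip J u zeta -> J v \is a fin_num ->
  0 < c -> c * ip zeta v <= c `^ p * fine (J v) + (p - 1) * fine (J u).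
Proof.
move=> uz Jv c0; have := subdiff_fine uz (fin_num_scale c Jv).
by rewrite fine_scale// (ipBr hip) (ipZr hip) (subdiff_euler uz); lra.
Qed.

(** Scaling a null vector costs no energy, so [c * ip zeta w] stays bounded above for all [c > 0];
    the same holds for the opposite vector. *)
Lemma subdiff_null u zeta v : subdiff ip J u zeta -> nullspace J v ->
  ip zeta v = 0.
Proof.
move=> uz; have le0 w : nullspace J w -> ip zeta w <= 0.
  rewrite /nullspace/= => Jw; rewrite leNgt; apply/negP => w0.
  have Jw' : J w \is a fin_num by rewrite Jw.
  (* With this [c], if positive, the test reads [k + 1 <= k]. Otherwise [k <= -1], and the test with
     scale 1 already contradicts [0 < ip zeta w]. *)
  pose c := ((p - 1) * fine (J u) + 1) / ip zeta w.
  set k := (p - 1) * fine (J u) in c.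
  have [c0|c0] := ltP 0 c.
    have := subdiff_test uz Jw' c0; rewrite Jw mulr0 add0r.
    by rewrite divfK ?gt_eqF// -/k; lra.
  have := subdiff_test uz Jw' ltr01; rewrite Jw mulr0 add0r mul1r -/k.
  move: c0; rewrite /c pmulr_lle0 ?invr_gt0//; lra.
move=> Jv; apply/eqP; rewrite eq_le le0//=.
rewrite -oppr_le0 -(ipC hip) -(ipNl hip) (ipC hip).
by apply: le0; rewrite /nullspace/= homN.
Qed.

End Functional.

(** * Differentiation along the gradient flow *)

Section Flow.
Set Implicit Arguments.
Unset Strict Implicit.
Context {R : realType} {V : completeNormedModType R} {ip : V -> V -> R}.
Context {J : V -> \bar R} {p : R} {f : V} {u : R -> V}.
Context (hip : is_inner_product ip) (Jconv : convex_fun J) (Jlsc : lsc J).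
Context (Jhom : abs_homogeneous p J) (p1 : 1 <= p) (p2 : p < 2).
Context (flow : gradient_flow ip J f u).
Implicit Types (r s t q l : R) (v : V).

Local Notation j t := (fine (J (u t))).

Lemma flow_continuous t : 0 < t -> {for t, continuous u}.
Proof.
case: flow => uc _ _ _ t0.
have : {within `]0, +oo[, continuous u}.
  apply: continuous_subspaceW uc => x /=; rewrite in_itv/= andbT.
  exact: ltW.
rewrite continuous_open_subspace//; apply.
by rewrite inE/= in_itv/= t0.
Qed.

Lemma flow_cvg0 : u @ 0^'+ --> f.
Proof.
case: flow => uc _ <- _.
have : {within `[0, 1], continuous u}.
  by apply: continuous_subspaceW uc => x /=; rewrite in_itv/= => /andP[].
by case/(continuous_within_itvP _ ltr01).
Qed.

Lemma flow_rderiv t : 0 < t -> exists2 zeta, subdiff ip J (u t) zeta &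
  (fun h : R => h^-1 *: (u (t + h) - u t)) @ 0^'+ --> - zeta.
Proof.
by case: flow => _ _ _ h /h[zeta [[zP _] zc]]; exists zeta.
Qed.

Lemma flow_rderiv_ip t : 0 < t -> exists2 zeta, subdiff ip J (u t) zeta &
  forall v, rderiv (fun s => ip (u s) v) t (- ip zeta v).
Proof.
move=> /flow_rderiv[zeta zP zc]; exists zeta => // v.
rewrite -(ipNl hip); apply: cvg_trans (cvg_ip hip zc (cvg_cst v)).
apply: near_eq_cvg; apply: nearW => h.
by rewrite (ipZl hip) (ipBl hip).
Qed.

Lemma flow_energy_fin t : 0 < t -> J (u t) = (j t)%:E.
Proof.
move=> /flow_rderiv[zeta zP _].
by rewrite fineK// (subdiff_fin_num Jconv Jhom zP).
Qed.

Lemma flow_energy_ge0 t : 0 <= j t.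
Proof. exact/fine_ge0/(hom_ge0 Jconv Jhom). Qed.

(** The difference quotient is the inner product of that of [u] with [u (t + h) + u t]; Euler's
    identity evaluates its limit. *)
Lemma flow_rderiv_sqr t : 0 < t ->
  rderiv (fun s => `|u s| ^+ 2) t (- (2 * (p * j t))).
Proof.
move=> t0; have [zeta zP zc] := flow_rderiv t0.
have uc : (fun h => u (t + h)) @ 0^'+ --> u t.
  have th : (fun h => t + h) @ 0^'+ --> t + 0.
    apply: cvg_at_right_filter.
    by apply: cvgD; [exact: cvg_cst | exact: cvg_id].
  by rewrite addr0 in th; exact: (cvg_comp _ _ th (flow_continuous t0)).
have -> : - (2 * (p * j t)) = ip (- zeta) (u t + u t).
  rewrite (ipNl hip) (ipDr hip).
  by rewrite (subdiff_euler hip Jconv Jhom zP); ring.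
apply: cvg_trans (cvg_ip hip zc (cvgD uc (cvg_cst (u t)))).
apply: near_eq_cvg; apply: nearW => h /=.
rewrite (ipZl hip) (ipBl hip) !fctE !(ipDr hip) !(ipxx hip) (ipC hip (u t)).
ring.
Qed.

Lemma flow_rderiv_powR t q : 0 < t -> u t != 0 ->
  rderiv (fun s => `|u s| `^ q) t (- (q * `|u t| `^ (q - 2) * (p * j t))).
Proof.
move=> t0 ut0; have N0 : 0 < `|u t| by rewrite normr_gt0.
have -> : (fun s => `|u s| `^ q) =
    (@powR R ^~ (q / 2)) \o (fun s => `|u s| ^+ 2).
  by apply/funext => s /=; rewrite -powR_mulrn// -powRrM mulrC divfK.
have -> : - (q * `|u t| `^ (q - 2) * (p * j t)) =
    (q / 2 * (`|u t| ^+ 2) `^ (q / 2 - 1)) * (- (2 * (p * j t))).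
  have -> : (`|u t| ^+ 2) `^ (q / 2 - 1) = `|u t| `^ (q - 2).
    by rewrite -powR_mulrn// -powRrM; congr (_ `^ _); field.
  by field.
apply: rderiv_comp; first exact: flow_rderiv_sqr.
by apply: is_derive1_powR; rewrite exprn_gt0.
Qed.

Lemma cvg_flow_powR {F : set_system R} {FF : Filter F} q x : 0 < q ->
  u @ F --> x -> (fun s => `|u s| `^ q) @ F --> `|x| `^ q.
Proof.
by move=> q0 ux; apply: cvg_powR => //; [exact: nearW | exact: cvg_norm].
Qed.

(** The squared norm is nonincreasing, since its right derivative [- (2 * (p * J (u t)))] is
    nonpositive. The square is used because this derivative exists even where [u] vanishes. *)
Lemma flow_extinct s t : 0 < s <= t -> u s = 0 -> u t = 0.
Proof.
move=> /andP[s0]; rewrite le_eqVlt => /predU1P[<-//|st] us0.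
have c2 r : 0 < r -> {for r, continuous (fun s => `|u s| ^+ 2)}.
  move=> r0; apply: (@cvg_comp _ _ _ _ (fun r : R => r ^+ 2) _ _ _
    (cvg_norm (flow_continuous r0))).
  exact: exprn_continuous.
have : `|u t| ^+ 2 <= `|u s| ^+ 2.
  apply: (@rderiv_le0_noninc _ (fun s => `|u s| ^+ 2) _ _ st).
  - by move=> r /andP[sr _]; apply: c2; exact: lt_trans sr.
  - by apply: cvg_at_right_filter; exact: c2.
  - by apply: cvg_at_left_filter; apply: c2; exact: lt_trans st.
  - move=> r /andP[sr _]; exists (- (2 * (p * j r))).
      by apply: flow_rderiv_sqr; exact: lt_trans sr.
    rewrite oppr_le0 !mulr_ge0 ?flow_energy_ge0//; exact: le_trans p1.
rewrite us0 normr0 expr0n/=; have := sqr_ge0 `|u t| => ? ?.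
by apply/eqP; rewrite -normr_eq0 -sqrf_eq0 eq_le; apply/andP.
Qed.

(** This makes coercivity applicable along the flow. Subgradients are orthogonal to the null space,
    so [ip (u t) w] has zero right derivative for a null vector [w] and starts at 0; monotonicity is
    applied to [w] and to its opposite. *)
Lemma flow_H0 t : H0 ip J f -> 0 < t -> u t != 0 -> H0 ip J (u t).
Proof.
move=> [fN _] t0 ut0; split=> // v.
have le0 w : nullspace J w -> ip (u t) w <= 0.
  move=> Jw; have cw F (FF : Filter F) x : u @ F --> x ->
    (fun s => ip (u s) w) @ F --> ip x w.
    by move=> ux; apply: (cvg_ip hip ux); exact: cvg_cst.
  have u0 : u 0 = f by case: flow.
  have -> : 0 = ip (u 0) w by rewrite u0 fN.
  apply: (@rderiv_le0_noninc _ (fun s => ip (u s) w) _ _ t0).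
  - by move=> s /andP[s0 _]; apply: cw; exact: flow_continuous.
  - by apply: cw; rewrite u0; exact: flow_cvg0.
  - by apply: cw; apply: cvg_at_left_filter; exact: flow_continuous.
  - move=> s /andP[s0 _]; have [zeta zP zc] := flow_rderiv_ip s0.
    exists (- ip zeta w) => //.
    by rewrite (subdiff_null hip Jconv Jhom zP Jw) oppr0.
move=> Jv; apply/eqP; rewrite eq_le le0//= -oppr_le0 (ipC hip) -(ipNl hip).
by rewrite (ipC hip) le0// /nullspace/= (homN Jhom).
Qed.

(** * Monotonicity of the Rayleigh quotient before the extinction time *)

Context {T : R} (T0 : 0 < T) (uT : u T = 0).
Context (u_neq0 : forall t, 0 < t < T -> u t != 0).

Definition rayleigh t := p * fine (J (u t)) / `|u t| `^ p.

Lemma flow_norm_powR_gt0 t q : 0 < t < T -> 0 < `|u t| `^ q.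
Proof. by move=> /u_neq0 ut0; rewrite powR_gt0// normr_gt0. Qed.

Lemma rayleigh_energy t : 0 < t < T -> p * j t = rayleigh t * `|u t| `^ p.
Proof. by move=> tT; rewrite /rayleigh divfK// gt_eqF// flow_norm_powR_gt0. Qed.

Lemma rayleigh_ge0 t : 0 <= rayleigh t.
Proof.
rewrite /rayleigh divr_ge0 ?powR_ge0// mulr_ge0//; last exact: flow_energy_ge0.
by rewrite (le_trans _ p1).
Qed.

Lemma rayleigh_coercive : coercive ip p J -> H0 ip J f ->
  exists2 c, 0 < c & forall t, 0 < t < T -> c <= rayleigh t.
Proof.
move=> [c [c0 cP]] fH; exists c => // t tT; have /andP[t0 _] := tT.
have := cP _ (flow_H0 fH t0 (u_neq0 tT)).
rewrite (flow_energy_fin t0) -EFinM lee_fin.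
by rewrite /rayleigh ler_pdivlMr ?flow_norm_powR_gt0.
Qed.

(** The midpoint [x] separates [l * |u t| ^ p] from [p * J (u t)]; near [t] the first stays below
    [x] by continuity, the second above it by lower semicontinuity. *)
Lemma rayleigh_lsc t l : 0 < t < T -> l < rayleigh t ->
  \forall s \near t, l < rayleigh s.
Proof.
move=> tT lt; have /andP[t0 tltT] := tT.
have uc := flow_continuous t0.
have p0 : 0 < p := lt_le_trans ltr01 p1.
move: lt; rewrite /rayleigh ltr_pdivlMr ?flow_norm_powR_gt0// => lt.
pose x := (l * `|u t| `^ p + p * j t) / 2.
have xj : ((x / p)%:E < J (u t))%E.
  by rewrite (flow_energy_fin t0) lte_fin ltr_pdivrMr// /x; lra.
have lx : l * `|u t| `^ p < x by rewrite /x; lra.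
have lc : (fun s => l * `|u s| `^ p) @ t --> l * `|u t| `^ p.
  by apply: cvgM; [exact: cvg_cst | exact: cvg_flow_powR].
near=> s.
have sT : 0 < s < T.
  apply/andP; split; near: s; [exact: lt_nbhsr | exact: lt_nbhsl].
have /andP[s0 _] := sT.
rewrite ltr_pdivlMr ?flow_norm_powR_gt0//.
apply: (@lt_trans _ _ x).
  by near: s; exact: (cvgr_lt _ lc).
rewrite -[_ * fine _]mulrC -ltr_pdivrMr// -lte_fin -flow_energy_fin//.
by near: s; exact: (uc _ (Jlsc xj)).
Unshelve. all: by end_near. Qed.

(* If the quotient exceeds its value at [s] just to the right of [s], then by
   the subgradient inequality the Cauchy-Schwarz defect of [u r] and [u s]
   strictly decreases there, although it is nonnegative and vanishes at
   [r = s]. *)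
Lemma rayleigh_noninc s t : 0 < s -> s <= t -> t < T ->
  rayleigh t <= rayleigh s.
Proof.
move=> s0; rewrite le_eqVlt => /predU1P[->//|st] tT.
rewrite leNgt; apply/negP => Lst.
have p0 : 0 < p := lt_le_trans ltr01 p1.
(* [x] is the last time at which the quotient is at most [rayleigh s], so the quotient exceeds
   [rayleigh x] on all of []x, t]]. The defect argument is run from [x]. *)
have [||x [/andP[sx xt] Lx] Lr] :=
  @last_point _ (fun r => rayleigh r <= rayleigh s) s t st (lexx _).
- by apply/negP; rewrite -ltNge.
- move=> x /andP[sx xt] /negP; rewrite -ltNge => Lx.
  have xT : 0 < x < T by rewrite (lt_trans s0)//= (le_lt_trans xt).
  have := rayleigh_lsc xT Lx => /(@cvg_at_left_filter _ _ id _ _ (@cvg_id _ _)).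
  by apply: filterS => y Ly; apply/negP; rewrite -ltNge.
have xT : 0 < x < T by rewrite (lt_le_trans s0 sx) (lt_trans xt tT).
pose N0 := `|u x|.
have N0p : 0 < N0 by rewrite normr_gt0 u_neq0.
pose G r := N0 * `|u r| + (-1) * ip (u r) (u x).
have G0 r : 0 <= G r by have := ip_le hip (u r) (u x); rewrite /G -/N0; nra.
have Gx : G x = 0 by rewrite /G (ipxx hip) -/N0; ring.
have Gc r : 0 < r -> {for r, continuous G}.
  move=> r0; have uc := flow_continuous r0.
  apply: cvgD; apply: cvgM; try exact: cvg_cst; first exact: cvg_norm.
  by apply: (cvg_ip hip uc); exact: cvg_cst.
have Gd r : x < r <= t -> exists2 l, rderiv G r l & l < 0.
  move=> xrt; have /andP[xr rt] := xrt.
  have r0 : 0 < r by case/andP: xT => x0 _; exact: lt_trans xr.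
  have rT : 0 < r < T by rewrite r0 (le_lt_trans rt).
  have /negP := Lr _ xrt; rewrite -ltNge => Lsr.
  have {}Lsr := le_lt_trans Lx Lsr.
  have [zeta zP zc] := flow_rderiv_ip r0.
  have m0 : 0 < `|u r| by rewrite normr_gt0 u_neq0.
  have Nd : rderiv (fun s => `|u s|) r (- (p * j r / `|u r|)).
    have := @flow_rderiv_powR r 1 r0 (u_neq0 rT).
    have -> : 1 - 2 = -1 :> R by lra.
    rewrite mul1r powR_inv1// [_^-1 * _]mulrC.
    by under eq_fun do rewrite powRr1//.
  exists (N0 * (- (p * j r / `|u r|)) + (-1) * (- ip zeta (u x))).
    by apply: rderivD; apply: rderivZ.
  (* The vector [c *: u x] has the norm of [u r] but a smaller quotient, hence a strictly smaller
     energy. *)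
  pose c := `|u r| / N0.
  have c0 : 0 < c by rewrite divr_gt0.
  have Jx : J (u x) \is a fin_num.
    by rewrite flow_energy_fin//; case/andP: xT.
  have := subdiff_test hip Jconv Jhom zP Jx c0 => test.
  have cj : c `^ p * j x < j r.
    have cp : c `^ p * N0 `^ p = `|u r| `^ p.
      by rewrite -powRM ?ltW// divfK// gt_eqF.
    have Np : 0 < N0 `^ p by rewrite powR_gt0.
    have cp0 : 0 < c `^ p by rewrite powR_gt0.
    rewrite -(ltr_pM2l p0) (rayleigh_energy rT) mulrCA (rayleigh_energy xT).
    by rewrite -cp -/N0 mulrCA ltr_pM2r// mulr_gt0.
  have cz : c * ip zeta (u x) < p * j r by lra.
  have -> : N0 * (- (p * j r / `|u r|)) + -1 * - ip zeta (u x) =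
    c^-1 * (c * ip zeta (u x) - p * j r).
    by rewrite /c; field; rewrite !gt_eqF.
  by rewrite pmulr_rlt0 ?invr_gt0//; lra.
pose y := (x + t) / 2.
have xy : x < y by rewrite /y; lra.
have yt : y < t by rewrite /y; lra.
have x0 : 0 < x by case/andP: xT.
have Gy : G y <= 0.
  rewrite -Gx; apply: (@rderiv_le0_noninc _ G _ _ xy).
  - by move=> r /andP[xr _]; apply: Gc; exact: lt_trans xr.
  - by apply: cvg_at_right_filter; exact: Gc.
  - by apply: cvg_at_left_filter; apply: Gc; exact: lt_trans xy.
  - move=> r /andP[xr ry]; have [|l ? ?] := Gd r.
      by rewrite xr ltW// (lt_trans ry).
    by exists l => //; exact: ltW.
(* The mean value inequality only yields [G y <= 0]; the negative right derivative at [y] then makes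
   [G] negative just after [y]. *)
have [|l Gl l0] := Gd y; first by rewrite xy ltW.
have /filter_ex[h Gh] := rderiv_lt0 Gl l0.
by have := G0 (y + h); lra.
Qed.

Lemma norm_powR_rderiv t : 0 < t < T ->
  rderiv (fun s => `|u s| `^ (2 - p)) t (- ((2 - p) * rayleigh t)).
Proof.
move=> tT; have /andP[t0 _] := tT.
have := @flow_rderiv_powR t (2 - p) t0 (u_neq0 tT).
have -> : 2 - p - 2 = - p by ring.
by rewrite powRN -mulrA [_^-1 * _]mulrC.
Qed.

(** The sign [b = 1] or [b = -1] covers upper and lower bounds on the quotient in one proof. The
    left end 0 is allowed in order to reach [f]. *)
Lemma norm_powR_slope b l s t : 0 <= s < t -> t <= T ->
  (forall r, s < r < t -> b * rayleigh r <= b * l) ->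
  b * `|u s| `^ (2 - p) <= b * (`|u t| `^ (2 - p) + (2 - p) * l * (t - s)).
Proof.
move=> /andP[s0 st] tT bl; have q0 : 0 < 2 - p by rewrite subr_gt0.
pose g r := (- b) * `|u r| `^ (2 - p) + (0 + (- (b * ((2 - p) * l))) * r).
have gc F (FF : Filter F) x : u @ F --> u x -> F --> x -> g @ F --> g x.
  move=> ux Fx; apply: cvgD.
    by apply: cvgM; [exact: cvg_cst | exact: cvg_flow_powR].
  apply: cvgD; first exact: cvg_cst.
  by apply: cvgM; [exact: cvg_cst | exact: Fx].
have gc0 x : 0 < x -> {for x, continuous g}.
  by move=> x0; apply: gc; [exact: flow_continuous | exact: cvg_id].
suff : g t <= g s by rewrite /g; lra.
have t0 : 0 < t := le_lt_trans s0 st.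
apply: (@rderiv_le0_noninc _ g _ _ st).
- by move=> r /andP[sr _]; apply: gc0; exact: le_lt_trans sr.
- move: s0; rewrite le_eqVlt => /predU1P[<-|s0].
    apply: gc; last by apply: cvg_at_right_filter; exact: cvg_id.
    by have [_ _ -> _] := flow; exact: flow_cvg0.
  by apply: cvg_at_right_filter; exact: gc0.
- by apply: cvg_at_left_filter; exact: gc0.
- move=> r srt; have /andP[sr rt] := srt.
  exists (- b * (- ((2 - p) * rayleigh r)) + - (b * ((2 - p) * l))).
    apply: rderivD; last exact: rderiv_aff.
    apply: rderivZ; apply: norm_powR_rderiv.
    by rewrite (le_lt_trans s0 sr) (lt_le_trans rt).
  by have := bl _ srt; nra.
Qed.

(** * The extinction profile and bounds in terms of it *)

Let lambda := ((2 - p) * T)^-1.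
Let a t := (1 - (2 - p) * lambda * t) `^ (2 - p)^-1.

Lemma extinction_rate_gt0 : 0 < lambda.
Proof. by rewrite invr_gt0 mulr_gt0// subr_gt0. Qed.

Lemma profile_base t : 1 - (2 - p) * lambda * t = (T - t) / T.
Proof. by rewrite /lambda; field; rewrite gt_eqF//= subr_eq0 gt_eqF. Qed.

Lemma profile_gt0 t : t < T -> 0 < a t.
Proof. by move=> tT; rewrite powR_gt0// profile_base divr_gt0// subr_gt0. Qed.

Lemma profile_powR t : t <= T -> a t `^ (2 - p) = (T - t) / T.
Proof.
move=> tT; rewrite -powRrM mulVf ?profile_base ?powRr1//.
  by rewrite divr_ge0 ?subr_ge0// ltW.
by rewrite subr_eq0 gt_eqF.
Qed.

Lemma profile_rderiv t : t < T -> rderiv a t (- (lambda * a t `^ (p - 1))).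
Proof.
move=> tT; have q0 : 2 - p != 0 by rewrite subr_eq0 gt_eqF.
have b0 : 0 < 1 + (- ((2 - p) * lambda)) * t.
  by rewrite mulNr profile_base divr_gt0// subr_gt0.
have -> : - (lambda * a t `^ (p - 1)) =
    (2 - p)^-1 * (1 + (- ((2 - p) * lambda)) * t) `^ ((2 - p)^-1 - 1) *
    (- ((2 - p) * lambda)).
  rewrite /a -mulNr -powRrM.
  have -> : (2 - p)^-1 * (p - 1) = (2 - p)^-1 - 1 by field.
  by rewrite [in RHS]mulNr mulNr; field.
have -> : a = (@powR R ^~ (2 - p)^-1) \o
    (fun s => 1 + (- ((2 - p) * lambda)) * s).
  by apply/funext => s; rewrite /a /= mulNr.
by apply: rderiv_comp; [exact: rderiv_aff | exact: is_derive1_powR].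
Qed.

Lemma profile_cvg {F : set_system R} {FF : Filter F} t :
  t <= T -> F --> t -> (\forall s \near F, s <= T) -> a @ F --> a t.
Proof.
move=> tT Ft FT; apply: cvg_powR.
- by rewrite invr_gt0 subr_gt0.
- apply: filterS FT => s sT.
  by rewrite profile_base divr_ge0 ?subr_ge0// ltW.
- by rewrite profile_base divr_ge0 ?subr_ge0// ltW.
- apply: cvgB; first exact: cvg_cst.
  by apply: cvgM; [exact: cvg_cst | exact: Ft].
Qed.

(** On [[t, T]] the quotient is at most [rayleigh s], and [u T = 0]; hence [|u t| ^ (2 - p)] is at
    most [(2 - p) * rayleigh s * (T - t)], which is [a t ^ (2 - p) * (rayleigh s / lambda)]. *)
Lemma flow_norm_ub s t : 0 < s <= t -> t < T ->
  `|u t| <= a t * (rayleigh s / lambda) `^ (2 - p)^-1.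
Proof.
move=> /andP[s0 st] tT; have t0 : 0 < t := lt_le_trans s0 st.
have q0 : 0 < 2 - p by rewrite subr_gt0.
have -> : `|u t| = (`|u t| `^ (2 - p)) `^ (2 - p)^-1.
  by rewrite -powRrM mulfV ?gt_eqF// powRr1.
rewrite /a -powRM; last 2 first.
- by rewrite profile_base divr_ge0 ?subr_ge0// ltW.
- by rewrite divr_ge0 ?rayleigh_ge0// ltW// extinction_rate_gt0.
have := @norm_powR_slope 1 (rayleigh s) t T.
rewrite uT normr0 powR0 ?gt_eqF// add0r !mul1r (ltW t0) tT lexx => /(_ isT isT).
move=> h; have {}h : `|u t| `^ (2 - p) <= (2 - p) * rayleigh s * (T - t).
  apply: h => r /andP[tr rT]; rewrite !mul1r; apply: rayleigh_noninc => //.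
  by rewrite (le_trans st)// ltW.
rewrite profile_base; apply: ge0_ler_powR.
- by rewrite invr_ge0 ltW.
- by rewrite nnegrE powR_ge0.
- rewrite nnegrE mulr_ge0//; first by rewrite divr_ge0 ?subr_ge0// ltW.
  by rewrite divr_ge0 ?rayleigh_ge0// ltW// extinction_rate_gt0.
- apply: (le_trans h); rewrite le_eqVlt; apply/orP; left; apply/eqP.
  by rewrite /lambda; field; rewrite gt_eqF//= subr_eq0 gt_eqF.
Qed.

(** The factor after [a t ^ p] depends on [s] only; along [s = sk k] it will converge to
    [lambda * |wstar| ^+ 2]. *)
Lemma flow_energy_ub s t : 0 < s <= t -> t < T ->
  p * j t <= a t `^ p *
    (rayleigh s * ((rayleigh s / lambda) `^ (2 - p)^-1) `^ p).
Proof.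
move=> st tT; have /andP[s0 st'] := st.
have t0T : 0 < t < T by rewrite (lt_le_trans s0).
rewrite rayleigh_energy// mulrCA -powRM ?powR_ge0//.
rewrite ler_pM ?rayleigh_ge0 ?powR_ge0//.
  exact: rayleigh_noninc.
apply: ge0_ler_powR; rewrite ?nnegrE ?mulr_ge0 ?powR_ge0//.
  exact: le_trans p1.
exact: flow_norm_ub.
Qed.

(* The scaled competitor [a r *: v] makes the right derivative of
   [ip (u r) v - K / lambda * a r] nonnegative up to the extinction time, where
   this function vanishes. *)
Lemma flow_test_bound t v : 0 < t < T -> J v \is a fin_num ->
  ip (u t) v <= a t / lambda * (fine (J v) + (p - 1) / p *
    (rayleigh t * ((rayleigh t / lambda) `^ (2 - p)^-1) `^ p)).
Proof.
move=> /andP[t0 tT] Jv; set B := rayleigh t * _; set K := fine (J v) + _.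
have p0 : 0 < p := lt_le_trans ltr01 p1.
have l0 := extinction_rate_gt0.
(* The sign is reversed to match [rderiv_le0_noninc]. *)
pose g r := (-1) * ip (u r) v + K / lambda * a r.
have gc F (FF : Filter F) x : x <= T -> u @ F --> u x -> F --> x ->
    (\forall s \near F, s <= T) -> g @ F --> g x.
  move=> xT ux Fx FT; apply: cvgD; (apply: cvgM; first exact: cvg_cst).
    by apply: (cvg_ip hip ux); exact: cvg_cst.
  exact: profile_cvg.
have gT : g T = 0.
  rewrite /g uT (ip0l hip) /a profile_base subrr mul0r powR0 ?mulr0 ?addr0//.
  by rewrite invr_eq0 subr_eq0 gt_eqF.
have -> : a t / lambda * K = K / lambda * a t by ring.
suff : g T <= g t by rewrite gT /g; lra.
apply: (@rderiv_le0_noninc _ g _ _ tT).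
- move=> r /andP[tr rT]; apply: gc; [exact: ltW | | exact: cvg_id | ].
    by apply: flow_continuous; exact: lt_trans tr.
  by near=> s; apply: ltW; near: s; exact: lt_nbhsl.
- apply: gc; [exact: ltW | | by apply: cvg_at_right_filter; exact: cvg_id | ].
    by apply: cvg_at_right_filter; exact: flow_continuous.
  exact: nbhs_right_le.
- apply: gc => //; [| by apply: cvg_at_left_filter; exact: cvg_id | ].
    by apply: cvg_at_left_filter; exact: flow_continuous.
  by near=> s; apply: ltW; near: s; exact: nbhs_left_lt.
- move=> r /andP[tr rT]; have r0 : 0 < r := lt_trans t0 tr.
  have [zeta zP zc] := flow_rderiv_ip r0.
  exists ((-1) * (- ip zeta v) + K / lambda * (- (lambda * a r `^ (p - 1)))).
    by apply: rderivD; apply: rderivZ => //; exact: profile_rderiv.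
  have a0 := profile_gt0 rT.
  have := subdiff_test hip Jconv Jhom zP Jv a0.
  have := @flow_energy_ub t r; rewrite t0 (ltW tr) => /(_ isT rT).
  rewrite -/B => jB.
  (* Writing [a r ^ p] as [a r * a r ^ (p - 1)] lets the scale [a r] of the competitor cancel. *)
  rewrite -mulr_powRB1 ?(ltW a0)// => test.
  have : a r * ip zeta v <= a r * a r `^ (p - 1) * K.
    apply: (le_trans test); rewrite /K mulrDr lerD2l.
    have -> : a r * a r `^ (p - 1) * ((p - 1) / p * B) =
      (p - 1) / p * (a r * a r `^ (p - 1) * B) by ring.
    rewrite mulr_powRB1 ?(ltW a0)//.
    have -> : (p - 1) * j r = (p - 1) / p * (p * j r).
      by field; rewrite gt_eqF.
    by rewrite ler_wpM2l// divr_ge0 ?subr_ge0// ltW.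
  rewrite -mulrA ler_pM2l// => le.
  have -> : K / lambda * - (lambda * a r `^ (p - 1)) = - (a r `^ (p - 1) * K).
    by field; rewrite gt_eqF.
  by lra.
Unshelve. all: by end_near. Qed.

Lemma profile_powR_norm t : 0 < t < T ->
  `|(a t)^-1 *: u t| `^ (2 - p) = `|u t| `^ (2 - p) * (T / (T - t)).
Proof.
move=> /andP[t0 tT]; have a0 := profile_gt0 tT.
rewrite normrZ gtr0_norm ?invr_gt0// powRM ?invr_ge0 ?(ltW a0)//.
by rewrite -powR_inv1 ?(ltW a0)// powRAC profile_powR ?(ltW tT)// powR_inv1
  ?divr_ge0 ?subr_ge0 ?ltW// mulrC invf_div.
Qed.

(** * Passage to the limit along the times [sk k] *)

Context {sk : nat -> R} {wstar : V}.
Context (fH0 : H0 ip J f) (Jcoer : coercive ip p J).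
Context (sk_in : forall k, 0 < sk k < T).
Context (sk_homo : {homo sk : m n / (m <= n)%N >-> m <= n}).
Context (skT : sk @ \oo --> T).
Context (wk : (fun k => (a (sk k))^-1 *: u (sk k)) @ \oo --> wstar).

Let w k := (a (sk k))^-1 *: u (sk k).

(** The quotient is nonincreasing along [sk], and coercivity keeps it above a positive constant.
    Every [t < T] is eventually passed by [sk], so the limit bounds the quotient from below at all
    times. *)
Lemma rayleigh_cvg : exists2 l : R, 0 < l &
  rayleigh (sk k) @[k --> \oo] --> l /\ forall t, 0 < t < T -> l <= rayleigh t.
Proof.
have [c c0 cL] := rayleigh_coercive Jcoer fH0.
have noninc : nonincreasing_seq (rayleigh \o sk).
  move=> m n mn /=; have /andP[m0 _] := sk_in m; have /andP[_ nT] := sk_in n.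
  by apply: rayleigh_noninc => //; exact: sk_homo.
have lb : has_lbound (range (rayleigh \o sk)).
  by exists c => _ [k _ <-] /=; exact: cL.
have cv := nonincreasing_is_cvgn noninc lb.
exists (lim (rayleigh \o sk @ \oo)).
  apply: lt_le_trans c0 _; apply: limr_ge => //.
  by apply: nearW => k; exact: cL.
split=> // t /andP[t0 tT].
have /cvgr_gt/(_ _ tT) [k _ /(_ k) tk] := skT.
apply: le_trans (nonincreasing_cvgn_ge noninc cv k) _ => /=.
by apply: rayleigh_noninc => //; [exact/ltW/tk/leqnn | case/andP: (sk_in k)].
Qed.

(** On [[sk k, T]] the quotient lies between [l] and [rayleigh (sk k)], so [|w k| ^ (2 - p)] is
    squeezed between [l / lambda] and [rayleigh (sk k) / lambda]. *)
Lemma profile_limit_rate (l : R) :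
  rayleigh (sk k) @[k --> \oo] --> l ->
  (forall t, 0 < t < T -> l <= rayleigh t) ->
  `|wstar| `^ (2 - p) = l / lambda.
Proof.
move=> Ll lL; have q0 : 0 < 2 - p by rewrite subr_gt0.
have wN : `|w k| `^ (2 - p) @[k --> \oo] --> `|wstar| `^ (2 - p).
  by apply: cvg_powR => //; [exact: nearW | exact: cvg_norm].
have lamE x : x / lambda = (2 - p) * x * T.
  by rewrite /lambda invrK; ring.
have wE k : `|w k| `^ (2 - p) = `|u (sk k)| `^ (2 - p) * (T / (T - sk k)).
  exact: profile_powR_norm.
have slope k b x : (forall r, sk k < r < T -> b * rayleigh r <= b * x) ->
    b * `|w k| `^ (2 - p) <= b * (x / lambda).
  move=> bx; have /andP[k0 kT] := sk_in k.
  have := @norm_powR_slope b x (sk k) T.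
  rewrite (ltW k0) kT lexx => /(_ isT isT bx).
  rewrite uT normr0 powR0 ?gt_eqF// add0r => h.
  have Tk : 0 < T - sk k by rewrite subr_gt0.
  rewrite wE mulrA -ler_pdivlMr ?divr_gt0// lamE invf_div.
  apply: (le_trans h); rewrite le_eqVlt; apply/orP; left; apply/eqP.
  by field; rewrite gt_eqF.
apply/eqP; rewrite eq_le; apply/andP; split.
  apply: ler_cvg_to wN (cvgM Ll (cvg_cst lambda^-1)) _.
  apply: nearW => k; have := slope k 1 (rayleigh (sk k)); rewrite !mul1r; apply.
  move=> r /andP[kr rT]; rewrite !mul1r; apply: rayleigh_noninc => //.
    by case/andP: (sk_in k).
  exact: ltW.
apply: (cvgr_to_ge wN); apply: nearW => k.
have := slope k (-1) l; rewrite !mulN1r lerN2; apply => r /andP[kr rT].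
rewrite !mulN1r lerN2; apply: lL; rewrite rT andbT.
by case/andP: (sk_in k) => k0 _; exact: lt_trans kr.
Qed.

Lemma profile_limit :
  [/\ subdiff ip J wstar (lambda *: wstar), wstar != 0 & `|wstar| <= `|f|].
Proof.
have [l l0 [Ll lL]] := rayleigh_cvg.
have NE := profile_limit_rate Ll lL.
have q0 : 0 < 2 - p by rewrite subr_gt0.
have p0 : 0 < p := lt_le_trans ltr01 p1.
have lam0 := extinction_rate_gt0.
have w0 : wstar != 0.
  apply/eqP => w0; move: NE; rewrite w0 normr0 powR0 ?gt_eqF//.
  by move/esym/eqP; rewrite gt_eqF// divr_gt0.
set N := `|wstar| in NE *; have N0 : 0 < N by rewrite normr_gt0.
have NM : (l / lambda) `^ (2 - p)^-1 = N.
  by rewrite -NE -powRrM mulfV ?gt_eqF// powRr1// ltW.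
have lN : l * N `^ p = lambda * N ^+ 2.
  have -> : l = lambda * N `^ (2 - p) by rewrite NE mulrC divfK// gt_eqF.
  rewrite -mulrA -powRD; last by rewrite (gt_eqF N0) implybT.
  by rewrite -powR_mulrn ?(ltW N0)//; congr (_ * _ `^ _); ring.
split => //.
(* The energies of [w k] converge to [l * N ^ p / p]. If [J wstar] exceeded this limit, lower
   semicontinuity would keep them eventually above some larger [r]. *)
- have Jw : (J wstar <= (lambda * N ^+ 2 / p)%:E)%E.
    rewrite leNgt; apply/negP => lJ.
    have [r lr rJ] : exists2 r, lambda * N ^+ 2 / p < r & (r%:E < J wstar)%E.
      move: lJ; case: (J wstar) => [x| |//].
        rewrite lte_fin => lx; exists ((lambda * N ^+ 2 / p + x) / 2).
          by lra.
        by rewrite lte_fin; lra.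
      by exists (lambda * N ^+ 2 / p + 1); [lra | exact: ltry].
    have Jwk k : J (w k) = (rayleigh (sk k) * `|w k| `^ p / p)%:E.
      have /andP[k0 kT] := sk_in k.
      have ai : 0 < (a (sk k))^-1 by rewrite invr_gt0 profile_gt0.
      have Jfin : J (u (sk k)) \is a fin_num by rewrite flow_energy_fin.
      rewrite -[LHS]fineK; last exact: (fin_num_scale Jhom).
      rewrite (fine_scale Jhom)// normrZ gtr0_norm// powRM ?(ltW ai)//.
      by congr EFin; rewrite mulrCA -rayleigh_energy//; field; rewrite gt_eqF.
    have : lambda * N ^+ 2 / p < lambda * N ^+ 2 / p; last by rewrite ltxx.
    apply: lt_le_trans lr _; rewrite -lN.
    have cv : rayleigh (sk k) * `|w k| `^ p / p @[k --> \oo] --> l * N `^ p / p.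
      apply: cvgM; last exact: cvg_cst.
      apply: cvgM => //; apply: cvg_powR => //; first exact: nearW.
        exact: ltW.
      exact: (cvg_norm wk).

    have Jr : \forall k \near \oo, (r%:E < J (w k))%E := wk (Jlsc rJ).
    apply: (cvgr_to_ge cv); apply: filterS Jr => k.
    by rewrite Jwk lte_fin => /ltW.
  move=> v; have [Jv|] := boolP (J v \is a fin_num); last first.
    rewrite ge0_fin_numE ?(hom_ge0 Jconv Jhom)// -leNgt leye_eq => /eqP ->.
    exact: leey.
  (* This is the limit of [flow_test_bound] at [sk k] divided by [a (sk k)], with
     [B l = l * N ^ p = lambda * N ^+ 2]. *)
  have test : ip wstar v <=
      lambda^-1 * (fine (J v) + (p - 1) / p * (lambda * N ^+ 2)).
    have cw : ip (w k) v @[k --> \oo] --> ip wstar v.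
      by apply: (cvg_ip hip wk); exact: cvg_cst.
    pose B x := x * ((x / lambda) `^ (2 - p)^-1) `^ p.
    have cB : B (rayleigh (sk k)) @[k --> \oo] --> B l.
      apply: cvgM => //; apply: cvg_powR => //.
      - by apply: nearW => k; rewrite powR_ge0.
      - by rewrite powR_ge0.
      - apply: cvg_powR.
        + by rewrite invr_gt0.
        + by apply: nearW => k; rewrite divr_ge0 ?rayleigh_ge0// ltW.
        + by rewrite divr_ge0// ltW.
        + by apply: cvgM => //; exact: cvg_cst.
    rewrite -lN -NM -/(B l).
    have cK : lambda^-1 * (fine (J v) + (p - 1) / p * B (rayleigh (sk k)))
        @[k --> \oo] --> lambda^-1 * (fine (J v) + (p - 1) / p * B l).
      apply: cvgM; first exact: cvg_cst.
      apply: cvgD; first exact: cvg_cst.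
      by apply: cvgM => //; exact: cvg_cst.
    apply: ler_cvg_to cw cK _; apply: nearW => k.
    have /andP[k0 kT] := sk_in k; have a0 := profile_gt0 kT.
    have := flow_test_bound (sk_in k) Jv; rewrite -/(B _) => h.
    by rewrite (ipZl hip) mulrC ler_pdivrMr// mulrAC [_^-1 * _]mulrC.
  rewrite -(fineK Jv); apply: le_trans (leeD2r _ Jw) _.
  rewrite -EFinD lee_fin (ipBr hip) !(ipZl hip) (ipxx hip) -/N.
  have : lambda * ip wstar v <= fine (J v) + (p - 1) / p * (lambda * N ^+ 2).
    by rewrite mulrC -ler_pdivlMr// mulrC.
  have -> : (p - 1) / p * (lambda * N ^+ 2) =
    lambda * N ^+ 2 - lambda * N ^+ 2 / p by field; rewrite gt_eqF.
  by lra.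
- have wN : `|w k| @[k --> \oo] --> N by exact: cvg_norm.
  apply: (cvgr_to_le wN); apply: nearW => k /=.
  have /andP[k0 kT] := sk_in k.
  have Tk : 0 < T - sk k by rewrite subr_gt0.
  (* [ub] and [lb] compare the convex function [|u| ^ (2 - p)] with its supporting line at [sk k],
     at the times [T] and 0. Together they put its value at [sk k] below the chord from
     [|f| ^ (2 - p)] at 0 to 0 at [T]. *)
  have ub : `|u (sk k)| `^ (2 - p) <=
      (2 - p) * rayleigh (sk k) * (T - sk k).
    have := @norm_powR_slope 1 (rayleigh (sk k)) (sk k) T.
    rewrite uT normr0 powR0 ?gt_eqF// add0r !mul1r (ltW k0) kT lexx.
    move=> /(_ isT isT); apply => r /andP[kr rT]; rewrite !mul1r.
    by apply: rayleigh_noninc => //; exact: ltW.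
  have lb : `|u (sk k)| `^ (2 - p) + (2 - p) * rayleigh (sk k) * sk k <=
      `|f| `^ (2 - p).
    have := @norm_powR_slope (-1) (rayleigh (sk k)) 0 (sk k).
    rewrite lexx k0 (ltW kT) subr0 !mulN1r lerN2.
    have [_ _ -> _] := flow.
    move=> /(_ isT isT); apply => r /andP[r0 rk]; rewrite !mulN1r lerN2.
    by apply: rayleigh_noninc => //; exact: ltW.
  suff : `|w k| `^ (2 - p) <= `|f| `^ (2 - p).
    rewrite leNgt => /negP h; rewrite leNgt; apply/negP => fw; apply: h.
    by apply: gt0_ltr_powR => //; rewrite nnegrE.
  rewrite profile_powR_norm// mulrA ler_pdivrMr//.
  set x := `|u (sk k)| `^ (2 - p) in ub lb *.
  set L := (2 - p) * rayleigh (sk k) in ub lb.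
  (* The goal follows by splitting [x * T] as [x * (T - sk k) + x * sk k] and bounding the last
     term. *)
  have : x * sk k <= L * sk k * (T - sk k).
    by rewrite mulrAC ler_pM2r.
  have : (x + L * sk k) * (T - sk k) <= `|f| `^ (2 - p) * (T - sk k).
    by rewrite ler_pM2r.
  by lra.
Qed.

End Flow.

(** * From the infimum defining the extinction time to the conclusion *)

Theorem theorem3 (R : realType) (V : completeNormedModType R)
  (ip : V -> V -> R) (J : V -> \bar R) (p : R) (f : V) (u : R -> V)
  (Tex : R) (tk : nat -> R) (wstar : V) :
  is_inner_product ip ->
  convex_fun J -> lsc J -> proper_fun J -> dense_domain J ->
  abs_homogeneous p J -> coercive ip p J ->
  1 <= p -> p < 2 ->
  H0 ip J f ->
  gradient_flow ip J f u ->
  Tex = inf (extinct_set u) ->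
  let lambda := ((2 - p) * Tex)^-1 in
  let a := fun t : R => (1 - (2 - p) * lambda * t) `^ (2 - p)^-1 in
  let w := fun t : R => (a t)^-1 *: u t in
  (forall k, 0 <= tk k < Tex) ->
  {homo tk : n m / (n < m)%N >-> n < m} ->
  tk @ \oo --> Tex ->
  (fun k => w (tk k)) @ \oo --> wstar ->
  [/\ subdiff ip J wstar (lambda *: wstar), wstar != 0 & `|wstar| <= `|f|].
Proof.
move=> hip Jconv Jlsc _ _ Jhom Jcoer p1 p2 fH flow TexE lambda a w.
move=> tk_in tk_homo tkT wk.
have T0 : 0 < Tex by have /andP[] := tk_in 0%N; exact: le_lt_trans.
have lb : has_lbound (extinct_set u) by exists 0 => x [/ltW].
(* The infimum of the empty set is 0 by convention, which [0 < Tex] excludes. *)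
have ne : extinct_set u !=set0.
  by apply/set0P/eqP => E; move: T0; rewrite TexE E inf0 ltxx.
(* The infimum is attained: [u] vanishes to the right of [Tex] and is continuous there. *)
have uT : u Tex = 0.
  have u0 t : Tex < t -> u t = 0.
    move=> Tt; have e0 : 0 < t - Tex by rewrite subr_gt0.
    have [x [_ xP]] := inf_adherent e0 (conj ne lb).
    by rewrite -TexE subrKC => /ltW /xP.
  have c0 : u @ Tex^'+ --> (0 : V).
    apply: (@cvg_trans _ ((fun=> (0 : V)) @ Tex^'+)); last exact: cvg_cst.
    apply: near_eq_cvg; near=> t; rewrite u0//; near: t; exact: nbhs_right_gt.
  have cT : u @ Tex^'+ --> u Tex.
    by apply: cvg_at_right_filter; exact: (flow_continuous flow T0).
  exact: (cvg_unique _ cT c0).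
have u_neq0 t : 0 < t < Tex -> u t != 0.
  move=> /andP[t0 tT]; apply/eqP => ut0.
  have /(ge_inf lb) : extinct_set u t.
    split=> // s ts; apply: (flow_extinct hip Jconv Jhom p1 flow _ ut0).
    by rewrite t0.
  by rewrite -TexE leNgt tT.
have tk_mono : {homo tk : n m / (n <= m)%N >-> n <= m}.
  move=> n m; rewrite leq_eqVlt => /predU1P[->//|nm]; exact/ltW/tk_homo.
(* [tk 0] may be 0, where no right derivative is given; shifting the index makes all times
   positive. *)
apply: (@profile_limit _ _ _ _ _ _ _ hip Jconv Jlsc Jhom p1 p2 flow _ T0 uT
  u_neq0 (fun k => tk k.+1)) => //.
- move=> k; have /andP[_ ->] := tk_in k.+1; rewrite andbT.
  by have /andP[tk0 _] := tk_in 0%N; exact: le_lt_trans tk0 (tk_homo _ _ _).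
- by move=> n m nm; exact: tk_mono.
- by rewrite (cvg_shiftS tk).
- by move: wk; rewrite -(cvg_shiftS (fun k => w (tk k))).
Unshelve. all: by end_near. Qed.
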